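(* Let $G:\mathbb{N}\to\mathbb{C}$ be multiplicative. Then exactly one of the following three cases occurs, with the stated conclusions. (A) $G$ is normal, i.e. $G(p)\neq 1$ for every prime $p$. If, for every $a\in\mathbb{N}$, the series $\sum_{r\ge1,\,(r,a)=1}G(r)\mu(r)$ converges, then $G$ is a Ramanujan coefficient, and $$G\in\langle \mathbf{0}\rangle \iff \sum_{q=1}^{\infty}G(q)\mu(q)=0.$$ (B) $G$ is sporadic, i.e. the set $\mathcal{F}(G)=\{p \text{ prime}: G(p)=1\}$ is non-empty but there is no prime $p$ with $G(p^K)=1$ for all $K\in\mathbb{N}_0$. If, for every $a\in\mathbb{N}$, the series $\sum_{r\ge1,\,(r,a)=1}G(r)\mu(r)$ converges, then $G$ is a Ramanujan coefficient, and $$G\in\langle \mathbf{0}\rangle \iff \sum_{q\ge1,\,(q,P(G))=1}G(q)\mu(q)=0,$$ where $P(G)=\prod_{p\in\mathcal{F}(G)}p$. (C) $G$ is exotic, i.e. there exists a prime $p$ with $G(p^K)=1$ for all $K\in\mathbb{N}_0$. If there exists such a prime $p_0$ for which $\sum_{q\ge1,\,(q,p_0)=1}G(q)c_q(a)$ converges for every $a\in\mathbb{N}$, then $G$ is a Ramanujan coefficient and $G\in\langle\mathbf{0}\rangle$.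
   Context: For $q,a\in\mathbb{N}$, the Ramanujan sum is $c_q(a)=\sum_{1\le h\le q,\,(h,q)=1}e^{2\pi i ah/q}$. A function $G:\mathbb{N}\to\mathbb{C}$ is a Ramanujan coefficient if $\sum_{q=1}^\infty G(q)c_q(a)$ converges for every $a\in\mathbb{N}$. $\langle\mathbf{0}\rangle$ denotes the set of $G:\mathbb{N}\to\mathbb{C}$ such that $\sum_{q=1}^\infty G(q)c_q(a)$ converges to $0$ for every $a\in\mathbb{N}$. $\mu$ is the Möbius function, $\mathbb{N}_0=\mathbb{N}\cup\{0\}$. Series $\sum_{q=1}^\infty$ are understood as limits of partial sums over $q\le x$, $x\to\infty$. (For a Ramanujan coefficient, $\mathcal{F}(G)$ is finite, so $P(G)$ is well defined.) *)

(* Defs.v *)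
From mathcomp Require Import all_boot all_order all_algebra.
From mathcomp Require Import all_classical all_reals all_analysis.
From mathcomp Require Import complex.

Set Implicit Arguments.
Unset Strict Implicit.
Unset Printing Implicit Defensive.

Import Order.TTheory GRing.Theory Num.Theory.
Import numFieldNormedType.Exports.

Local Open Scope classical_set_scope.
Local Open Scope ring_scope.
Local Open Scope complex_scope.

(* Arithmetic functions, defined on the positive integers, are encoded as
   functions on [nat]; their value at 0 is never used. *)

(* Stated over a generic [numFieldType], whose topology is that of the norm
   [`|_|]; it is used at [R[i]], where the norm is the modulus. *)
Section Series.
Variable K : numFieldType.
Implicit Types (P : pred nat) (u : nat -> K) (l : K).

Definition partial_sum P u (x : nat) : K := \sum_(1 <= q < x.+1 | P q) u q.

Definition series_to P u l : Prop := partial_sum P u @ \oo --> l.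

Definition series_cvg P u : Prop := exists l, series_to P u l.

End Series.

Section Definitions.
Variable R : realType.
Implicit Types G : nat -> R[i].

Definition expi (x : R) : R[i] := cos x +i* sin x.

Definition ramanujan_sum (q a : nat) : R[i] :=
  \sum_(1 <= h < q.+1 | coprime h q) expi (2 * pi * a%:R * h%:R / q%:R).

Definition mobius (n : nat) : R[i] :=
  if (0 < n)%N && all (fun p => logn p n == 1%N) (primes n)
  then (-1) ^+ size (primes n) else 0.

Definition multiplicative_fun G : Prop :=
  G 1%N = 1 /\ forall m n : nat,
    (0 < m)%N -> (0 < n)%N -> coprime m n -> G (m * n)%N = G m * G n.

Definition ramanujan_coefficient G : Prop :=
  forall a : nat, (0 < a)%N ->
    series_cvg xpredT (fun q => G q * ramanujan_sum q a).

Definition null_coefficients : set (nat -> R[i]) :=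
  [set G | forall a : nat, (0 < a)%N ->
    series_to xpredT (fun q => G q * ramanujan_sum q a) 0].

Definition unit_primes G : set nat := [set p | prime p /\ G p = 1].

(* [\big[_/_]_(_ \in A) _] is the genuine product when [A] is finite, and 1
   otherwise. *)
Definition unit_primes_prod G : nat := \big[muln/1%N]_(p \in unit_primes G) p.

Definition exotic_prime G (p : nat) : Prop :=
  prime p /\ forall K : nat, G (p ^ K)%N = 1.

Definition normal_coef G : Prop := forall p : nat, prime p -> G p <> 1.

Definition exotic_coef G : Prop := exists p : nat, exotic_prime G p.

Definition sporadic_coef G : Prop :=
  unit_primes G !=set0 /\ ~ exists p : nat, exotic_prime G p.

End Definitions.

Definition exactly_one (A B C : Prop) : Prop :=
  [\/ A, B | C] /\ [/\ ~ (A /\ B), ~ (A /\ C) & ~ (B /\ C)].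

Arguments mobius {R} n.
Arguments ramanujan_sum {R} q a.
Arguments null_coefficients {R}.

(* Main.v *)
(** Let [H] be multiplicative on coprime arguments, and let [p] be a prime with
    [H (p ^ k) = 0] for all large [k].  Writing [q = p ^ k * r] with [p] not
    dividing [r] splits the partial sum of [H] up to [x] into finitely many
    partial sums up to [x %/ p ^ k] over the [r] prime to [p], so the sum of [H]
    is the local factor [\sum_k H (p ^ k)] times the sum over [r] prime to [p].

    This applies to [H q = G q * mobius q], with local factor [1 - G p], and to
    [H q = G q * ramanujan_sum q a], which agrees with the former when [q] is
    prime to [a].  If [G (p ^ k) = 1] for all [k <= v], where [v = logn p a], the
    local factor of the latter is [p ^ v * (1 - G (p ^ v.+1))].  It vanishes at
    an exotic prime; at a non-exotic prime of [unit_primes G] it is nonzero for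
    the right choice of [v], and at all other primes [1 - G p] is nonzero. *)

Require Import Defs.
From mathcomp Require Import all_boot all_order all_algebra.
From mathcomp Require Import all_classical all_reals all_analysis.
From mathcomp Require Import complex.

Set Implicit Arguments.
Unset Strict Implicit.

Import Order.TTheory GRing.Theory Num.Theory.
Import numFieldNormedType.Exports.

Local Open Scope classical_set_scope.
Local Open Scope ring_scope.
Local Open Scope complex_scope.

(** * Sieving a series by finitely many primes *)

(** Coprimality is kept as a list of primes so that they can be removed one at a time, by induction
    on the list. *)
Definition sieve (s : seq nat) (r : nat) : bool := all (fun p => ~~ (p %| r)%N) s.

Lemma coprime_sieve (n r : nat) : (0 < n)%N -> (0 < r)%N ->
  coprime r n = sieve (primes n) r.
Proof.
move=> n0 r0; rewrite coprime_has_primes // -all_predC.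
by apply: eq_in_all => p; rewrite /= !mem_primes r0 => /andP[-> _].
Qed.

Lemma eq_mem_sieve (s t : seq nat) : s =i t -> sieve s =1 sieve t.
Proof. by move=> st r; apply: eq_all_r. Qed.

Lemma big_nat_dvdn (V : nmodType) (d x : nat) (P : pred nat) (F : nat -> V) :
  (0 < d)%N ->
  \sum_(1 <= q < x.+1 | (d %| q)%N && P q) F q =
  \sum_(1 <= r < (x %/ d).+1 | P (d * r)%N) F (d * r)%N.
Proof.
move=> d0; elim: x => [|x IH]; first by rewrite div0n !big_geq.
rewrite big_mkcond big_nat_recr //= -big_mkcond IH divnS //.
case: (boolP (d %| x.+1)%N) => [dx|_] /=; last by rewrite addr0 add0n.
rewrite add1n [RHS]big_mkcond big_nat_recr //= -big_mkcond; congr (_ + _).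
suff -> : (d * (x %/ d).+1)%N = x.+1 by [].
by rewrite mulnC -(divnK dx) divnS // dx add1n.
Qed.

Lemma big_nat0_dvdn (V : nmodType) (d m : nat) (F : nat -> V) :
  (0 < d)%N -> (0 < m)%N ->
  \sum_(0 <= h < d * m | (d %| h)%N) F h = \sum_(0 <= j < m) F (d * j)%N.
Proof.
case: m => // m d0 _; rewrite [RHS]big_ltn // muln0.
have -> : (d * m.+1 = (m * d + d.-1).+1)%N by rewrite mulnS mulnC addnC -addnS prednK.
rewrite [LHS]big_ltn_cond // dvdn0; congr (_ + _).
under eq_bigl do rewrite -[(_ %| _)%N]andbT.
by rewrite (big_nat_dvdn _ (fun=> true)) // divnMDl // divn_small ?addn0 // prednK.
Qed.

(** Cancels a unit modulo [m]; this gives injectivity of the Chinese remainder map in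
    [ramanujan_sumM]. *)
Lemma eqn_modMr_inj (m n h k : nat) : coprime n m -> (h < m)%N -> (k < m)%N ->
  h * n == k * n %[mod m] -> h = k.
Proof.
move=> co; wlog hk : h k / (h <= k)%N => [W|] hm km.
  by case/orP: (leq_total h k) => ?; [|rewrite eq_sym => ?; apply/esym]; apply: W.
rewrite eq_sym eqn_mod_dvd ?leq_mul2r ?hk ?orbT // -mulnBl Gauss_dvdl 1?coprime_sym //.
move=> dv; apply/eqP; rewrite eqn_leq hk -subn_eq0; apply/eqP.
case: (posnP (k - h)) => // kh; move: (dvdn_leq kh dv).
by rewrite leqNgt (leq_ltn_trans (leq_subr _ _) km).
Qed.

Section PrimeSplitting.
Variable K : numFieldType.
Implicit Types (P Q : pred nat) (u H : nat -> K) (l : K).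

Definition coprime_multiplicative H : Prop := forall m n : nat,
  (0 < m)%N -> (0 < n)%N -> coprime m n -> H (m * n)%N = H m * H n.

Lemma eq_series_to P Q u v l :
  (forall r, (0 < r)%N -> P r = Q r) ->
  (forall r, (0 < r)%N -> Q r -> u r = v r) ->
  series_to P u l -> series_to Q v l.
Proof.
move=> PQ uv; rewrite /series_to.
suff -> : partial_sum P u = partial_sum Q v by [].
apply/funext => x; rewrite /partial_sum big_nat_cond [RHS]big_nat_cond.
apply: eq_big => [r|r]; first by case: (ltnP 0 r) => //= r0; rewrite PQ.
by case/andP => /andP[r0 _]; rewrite PQ // => Qr; rewrite uv.
Qed.

Lemma series_to_unique P u l l' : series_to P u l -> series_to P u l' -> l = l'.
Proof. exact/cvg_unique/norm_hausdorff. Qed.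

Lemma partial_sum_sieve (H : nat -> K) p N (s : seq nat) x :
  coprime_multiplicative H -> prime p -> all prime s -> p \notin s ->
  (forall k, (N <= k)%N -> H (p ^ k)%N = 0) ->
  partial_sum (sieve s) H x =
  \sum_(k < N) H (p ^ k)%N * partial_sum (sieve (p :: s)) H (x %/ p ^ k).
Proof.
move=> Hmul p_pr s_pr ps HN.
have p0 k : (0 < p ^ k)%N by rewrite expn_gt0 prime_gt0.
have Hp k m : (0 < m)%N -> ~~ (p %| m)%N -> H (p ^ k * m)%N = H (p ^ k)%N * H m.
  by move=> m0 pm; rewrite Hmul // coprimeXl // prime_coprime.
have sp k r : sieve s (p ^ k * r) = sieve s r.
  apply: eq_in_all => p' p's; have p'_pr := allP s_pr _ p's.
  rewrite Euclid_dvdM // Euclid_dvdX // dvdn_prime2 //.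
  by case: eqP => [e|//]; rewrite -e p's in ps.
(* The inner sum keeps the single index [k = logn p q], or is empty when [logn p q] is at least [N],
   in which case [H q] vanishes. *)
have -> : partial_sum (sieve s) H x =
    \sum_(1 <= q < x.+1 | sieve s q) \sum_(k < N | logn p q == k) H q.
  rewrite /partial_sum big_nat_cond [RHS]big_nat_cond.
  apply: eq_bigr => q /andP[/andP[q0 _] _].
  case: (ltnP (logn p q) N) => qN.
    by rewrite (big_pred1 (Ordinal qN)) // => k; rewrite -val_eqE /= eq_sym.
  rewrite big_pred0 => [|k]; last first.
    by apply/eqP => e; move: (ltn_ord k); rewrite -e ltnNge qN.
  have [m pm qE] := pfactor_coprime p_pr q0.
  have m0 : (0 < m)%N by move: q0; rewrite qE muln_gt0 => /andP[].
  by rewrite qE mulnC Hp ?HN ?mul0r // -prime_coprime.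
rewrite (exchange_big_dep xpredT) //=; apply: eq_bigr => k _.
(* Divisibility by [p ^ k] follows from the valuation; making it explicit allows the substitution
   [q = p ^ k * r]. *)
have -> : \sum_(1 <= q < x.+1 | sieve s q && (logn p q == k)) H q =
    \sum_(1 <= q < x.+1 | (p ^ k %| q)%N && (sieve s q && (logn p q == k))) H q.
  rewrite big_nat_cond [RHS]big_nat_cond; apply: eq_bigl => q.
  case: (ltnP 0 q) => //= q0; rewrite pfactor_dvdn //.
  by case: eqP => [->|]; rewrite ?leqnn ?andbF.
rewrite big_nat_dvdn // /partial_sum mulr_sumr big_nat_cond [RHS]big_nat_cond.
have sk r : (0 < r)%N ->
    sieve s (p ^ k * r) && (logn p (p ^ k * r) == k) = sieve (p :: s) r.
  move=> r0; rewrite sp lognM // pfactorK // -{2}[nat_of_ord k]addn0 eqn_add2l.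
  by rewrite andbC -[_ == _]negbK -lt0n logn_gt0 mem_primes p_pr r0.
apply: eq_big => [r|r]; first by case: (ltnP 0 r) => //= r0; rewrite sk.
case/andP => /andP[r0 _]; rewrite sk // => /andP[pr _]; exact: Hp.
Qed.

(** For fixed [k], [x %/ p ^ k] tends to infinity with [x], so each of the [N] terms in
    [partial_sum_sieve] tends to [H (p ^ k) * l]. *)
Lemma series_to_sieve1 (H : nat -> K) p N (s : seq nat) l :
  coprime_multiplicative H -> prime p -> all prime s -> p \notin s ->
  (forall k, (N <= k)%N -> H (p ^ k)%N = 0) ->
  series_to (sieve (p :: s)) H l ->
  series_to (sieve s) H ((\sum_(k < N) H (p ^ k)%N) * l).
Proof.
move=> Hmul p_pr s_pr ps HN Hl; rewrite /series_to.
rewrite (_ : partial_sum _ _ = fun x => \sum_(k < N) H (p ^ k)%N *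
    partial_sum (sieve (p :: s)) H (x %/ p ^ k)); last first.
  by apply/funext => x; apply: partial_sum_sieve.
rewrite mulr_suml; apply: cvg_big => [|k _]; first exact: add_continuous.
apply: cvgMl_tmp; have pk0 : (0 < p ^ k)%N by rewrite expn_gt0 prime_gt0.
exact: cvg_comp (cvg_divnr _ pk0) Hl.
Qed.

Lemma series_to_sieve (H : nat -> K) (N : nat -> nat) (s t : seq nat) l :
  coprime_multiplicative H -> all prime (s ++ t) -> uniq (s ++ t) ->
  (forall p k, p \in s -> (N p <= k)%N -> H (p ^ k)%N = 0) ->
  series_to (sieve (s ++ t)) H l ->
  series_to (sieve t) H ((\prod_(p <- s) \sum_(k < N p) H (p ^ k)%N) * l).
Proof.
move=> Hmul; elim: s l => [|p s IH] l /=; first by rewrite big_nil mul1r.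
case/andP => p_pr s_pr /andP[ps us] HN Hl; rewrite big_cons mulrAC mulrC.
apply: IH => // [p' k p's|]; first by apply: HN; rewrite inE p's orbT.
by apply: series_to_sieve1 => // k; apply: HN; rewrite inE eqxx.
Qed.

(** Each term is a difference of consecutive partial sums. This later bounds the set
    [unit_primes G]. *)
Lemma series_to_term0 u l : series_to xpredT u l -> u n @[n --> \oo] --> 0.
Proof.
move=> ul; suff : u n.+1 @[n --> \oo] --> 0 by rewrite (cvg_shiftS u).
have -> : (fun n => u n.+1) = partial_sum xpredT u \o S \- partial_sum xpredT u.
  apply/funext => n; rewrite /= /partial_sum [X in X - _]big_nat_recr //=.
  by rewrite addrAC subrr add0r.
rewrite -(subrr l); apply: cvgB => //.
suff : partial_sum xpredT u n.+1 @[n --> \oo] --> l by [].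
by rewrite (cvg_shiftS (partial_sum xpredT u)).
Qed.

End PrimeSplitting.

(** * Ramanujan sums *)

Section RamanujanSums.
Variable R : realType.
Implicit Types (m n q a h : nat).

Lemma expiD (x y : R) : expi (x + y) = expi x * expi y.
Proof. by rewrite /expi cosD sinD; simpc; congr (_ +i* _); rewrite addrC. Qed.

Lemma expi0 : expi (0 : R) = 1.
Proof. by rewrite /expi cos0 sin0. Qed.

Lemma expiMn (x : R) n : expi (x *+ n) = expi x ^+ n.
Proof. by elim: n => [|n IH]; rewrite ?mulr0n ?expi0 // mulrS exprS expiD IH. Qed.

(** The real part is [1 - 2 * sin (x / 2) ^+ 2], and the sine is positive strictly between 0 and
    [pi]. *)
Lemma expi_neq1 (x : R) : 0 < x < 2 * pi -> expi x != 1.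
Proof.
case/andP=> x0 x2; apply/eqP => -[cx _]; move: cx.
have -> : x = (x / 2) *+ 2 by rewrite -mulr_natr divfK.
rewrite cos_mulr2n cos2sin2 => /eqP.
have s0 : 0 < sin (x / 2).
  by apply: sin_gt0_pi; rewrite divr_gt0 //= ltr_pdivrMr // mulrC.
rewrite subr_eq -mulr2n mulrnBl -subr_eq0 addrAC subrr sub0r.
rewrite oppr_eq0 mulrn_eq0 /= expf_eq0 /=.
by rewrite (gt_eqF s0).
Qed.

(** For positive [q], the standard primitive [q]-th root of unity. *)
Definition rootu q : R[i] := expi (2 * pi / q%:R).

Lemma rootuE q a h :
  expi (2 * pi * a%:R * h%:R / q%:R) = rootu q ^+ (a * h).
Proof.
rewrite /rootu -expiMn -[X in _ = expi X]mulr_natr natrM; congr expi.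
by rewrite -!mulrA; congr (_ * (_ * _)); rewrite mulrA mulrC.
Qed.

Lemma rootuX q d k : (0 < d)%N -> (0 < q)%N ->
  rootu (d * q) ^+ (d * k) = rootu q ^+ k.
Proof.
move=> d0 q0; rewrite /rootu -!expiMn mulrnA; congr (expi (_ *+ _)).
rewrite -[LHS]mulr_natr -mulrA; congr (_ * _).
rewrite natrM invfM mulrAC mulVf ?mul1r //.
by rewrite pnatr_eq0 -lt0n.
Qed.

Lemma rootu_unity q : (0 < q)%N -> rootu q ^+ q = 1.
Proof.
move=> q0; rewrite -{2}[q]muln1 -{1}[q]muln1 rootuX // expr1 /rootu divr1.
by rewrite /expi mulr_natl cos2pi sin2pi.
Qed.

Lemma rootu_mod q k : (0 < q)%N -> rootu q ^+ (k %% q) = rootu q ^+ k.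
Proof.
move=> q0; rewrite {2}(divn_eq k q) exprD mulnC exprM rootu_unity //.
by rewrite expr1n mul1r.
Qed.

Lemma rootu_eq1 q k : (0 < q)%N -> (rootu q ^+ k == 1) = (q %| k)%N.
Proof.
move=> q0; apply/idP/idP => [|/dvdnP[j ->]]; last first.
  by rewrite mulnC exprM rootu_unity // expr1n.
(* Reducing the exponent modulo [q] puts the angle strictly between 0 and [2 * pi]. *)
apply: contraLR; rewrite -rootu_mod // /dvdn -lt0n => k0.
rewrite /rootu -expiMn; apply: expi_neq1.
have qR : (0 : R) < q%:R by rewrite ltr0n.
rewrite pmulrn_lgt0 // divr_gt0 ?mulr_gt0 ?pi_gt0 //=.
rewrite -[X in X < _]mulr_natr mulrAC ltr_pdivrMr // ltr_pM2l ?mulr_gt0 ?pi_gt0 //.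
by rewrite ltr_nat ltn_pmod.
Qed.

Lemma ramanujan_sumE q a : (0 < q)%N ->
  ramanujan_sum q a = \sum_(h < q | coprime h q) rootu q ^+ (a * h).
Proof.
move=> q0; rewrite /ramanujan_sum.
under eq_bigr do rewrite rootuE.
rewrite -(big_mkord (fun h => coprime h q) (fun h => rootu q ^+ (a * h))).
rewrite big_mkcond [RHS]big_mkcond /=.
set F := fun h => if coprime h q then rootu q ^+ (a * h) else 0.
(* The definition sums over [1..q], the goal over [0..q-1]; the two end terms agree. *)
have F0q : F q = F 0%N.
  rewrite /F /coprime gcdnn gcd0n muln0 expr0 mulnC exprM rootu_unity //.
  by rewrite expr1n.
apply: (addrI (F 0%N)); rewrite -(big_ltn (F := F)) // big_nat_recr //= F0q.
exact: addrC.
Qed.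

(** By the Chinese remainder theorem, [h = h1 * n + h2 * m] modulo [m * n] matches pairs of residues
    with residues, respects coprimality, and factors the root of unity. *)
Lemma ramanujan_sumM a m n : (0 < m)%N -> (0 < n)%N -> coprime m n ->
  ramanujan_sum (m * n) a = ramanujan_sum m a * ramanujan_sum n a :> R[i].
Proof.
move=> m0 n0 co; have mn0 : (0 < m * n)%N by rewrite muln_gt0 m0.
rewrite !ramanujan_sumE // big_distrlr pair_big /=.
pose f (h : 'I_m * 'I_n) : 'I_(m * n) :=
  Ordinal (ltn_pmod (h.1 * n + h.2 * m) mn0).
have em x y : ((x * n + y * m) %% m = (x * n) %% m)%N by rewrite addnC modnMDl.
have f_inj : injective f.
  move=> [h1 h2] [k1 k2] [/eqP]; rewrite chinese_remainder // => /andP[].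
  rewrite !em !modnMDl => h12 h34; congr (_, _); apply/val_inj.
    by apply: eqn_modMr_inj h12; rewrite // coprime_sym.
  exact: eqn_modMr_inj h34.
have f_bij : bijective f.
  by apply: inj_card_bij f_inj _; rewrite card_prod !card_ord.
rewrite (reindex f) /=; last exact: onW_bij.
apply: eq_big => [[h1 h2]|[h1 h2] _] /=.
  rewrite coprime_modl coprimeMr -coprime_modl em coprime_modl coprimeMl.
  rewrite [coprime n m]coprime_sym co andbT; congr (_ && _).
  by rewrite -coprime_modl modnMDl coprime_modl coprimeMl co andbT.
rewrite -rootu_mod // modnMmr rootu_mod // mulnDr exprD.
rewrite [(h1 * n)%N]mulnC mulnCA [(m * n)%N]mulnC rootuX //.
by rewrite [(h2 * m)%N]mulnC mulnCA [(n * m)%N]mulnC rootuX.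
Qed.

(** Closed form of the sum of the [a]-th powers of all [q]-th roots of unity; see [sum_rootu]. *)
Definition root_sum q a : R[i] := if (q %| a)%N then q%:R else 0.

Lemma sum_rootu q a : (0 < q)%N -> \sum_(h < q) rootu q ^+ (a * h) = root_sum q a.
Proof.
move=> q0; under eq_bigr do rewrite exprM.
rewrite /root_sum -rootu_eq1 //; case: eqP => [->|/eqP ne].
  by under eq_bigr do rewrite expr1n; rewrite sumr_const card_ord.
(* Geometric series: [(z - 1)] times the sum is [z ^+ q - 1 = 0], with [z != 1]. *)
have := subrX1 (rootu q ^+ a) q.
rewrite exprAC rootu_unity // expr1n subrr => /esym/eqP.
by rewrite mulf_eq0 subr_eq0 (negPf ne) => /eqP.
Qed.

Lemma ramanujan_sum1 a : ramanujan_sum 1 a = 1 :> R[i].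
Proof. by rewrite ramanujan_sumE // big_mkcond big_ord1 /= muln0. Qed.

(** The residues not prime to [p ^ k.+1] are the multiples [p * j]; they contribute the full sum of
    roots for [p ^ k]. *)
Lemma ramanujan_sum_pfactor p k a : prime p ->
  ramanujan_sum (p ^ k.+1) a = root_sum (p ^ k.+1) a - root_sum (p ^ k) a.
Proof.
move=> p_pr; have p0 := prime_gt0 p_pr.
have pk0 j : (0 < p ^ j)%N by rewrite expn_gt0 p0.
rewrite ramanujan_sumE // -!sum_rootu //.
rewrite [X in _ = X - _](bigID (fun h : 'I__ => coprime h (p ^ k.+1))) /=.
apply/esym/eqP; rewrite subr_eq; apply/eqP; congr (_ + _).
have pX : (p ^ k.+1 = p * p ^ k)%N by rewrite expnS.
rewrite -(big_mkord xpredT (fun h => rootu (p ^ k) ^+ (a * h))).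
rewrite -(big_mkord (fun h => ~~ coprime h (p ^ k.+1))
  (fun h => rootu (p ^ k.+1) ^+ (a * h))).
under eq_bigl do rewrite coprime_pexpr // coprime_sym prime_coprime // negbK.
rewrite pX big_nat0_dvdn //; apply: eq_bigr => j _.
by rewrite mulnCA rootuX.
Qed.

End RamanujanSums.

(** * The Moebius function *)

Section Mobius.
Variable R : realType.
Implicit Types (m n q a p k : nat).

Lemma mobius1 : mobius 1 = 1 :> R[i].
Proof. by []. Qed.

Lemma mobius_pfactor p k : prime p ->
  mobius (p ^ k.+1) = (if k is 0%N then -1 else 0) :> R[i].
Proof.
move=> p_pr; rewrite /mobius expn_gt0 prime_gt0 // primesX // primes_prime //=.
by rewrite pfactorK // andbT; case: k => [|k]; rewrite ?expr1.
Qed.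

Lemma mobiusM : coprime_multiplicative (@mobius R).
Proof.
move=> m n m0 n0 co; rewrite /mobius muln_gt0 m0 n0 /=.
have pmn : perm_eq (primes (m * n)) (primes m ++ primes n).
  apply: uniq_perm; first exact: primes_uniq.
    by rewrite cat_uniq !primes_uniq -coprime_has_primes // co.
  by move=> p; rewrite mem_cat primesM.
have lm (x y : nat) : (0 < x)%N -> (0 < y)%N -> coprime x y ->
    all (fun p => logn p (x * y) == 1%N) (primes x) =
    all (fun p => logn p x == 1%N) (primes x).
  move=> x0 y0 cxy; apply: eq_in_all => p; rewrite mem_primes => /and3P[_ _ px].
  by rewrite lognM // (logn_coprime (coprime_dvdl px cxy)) addn0.
rewrite (perm_all _ pmn) (perm_size pmn) all_cat size_cat lm //.
rewrite mulnC lm // 1?coprime_sym //.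
by case: all; case: all; rewrite ?mulr0 ?mul0r // exprD.
Qed.

Lemma ramanujan_sum_pfactor_eq0 p k a : prime p -> (0 < a)%N ->
  (logn p a < k)%N -> ramanujan_sum (p ^ k.+1) a = 0 :> R[i].
Proof.
move=> p_pr a0 ak; rewrite ramanujan_sum_pfactor // /root_sum !pfactor_dvdn //.
by rewrite leqNgt ltnS ltnW // leqNgt ak subrr.
Qed.

(** The sum telescopes by [ramanujan_sum_pfactor]. *)
Lemma sum_ramanujan_sum_pfactor p N a : prime p ->
  \sum_(k < N.+1) ramanujan_sum (p ^ k) a = root_sum R (p ^ N) a.
Proof.
move=> p_pr; elim: N => [|N IH].
  by rewrite big_ord1 expn0 ramanujan_sum1 /root_sum dvd1n.
by rewrite big_ord_recr /= IH ramanujan_sum_pfactor // addrC subrK.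
Qed.

(** Both sides are multiplicative, so strong induction, splitting off the full power of the least
    prime factor, reduces to prime powers. There [root_sum (p ^ j) a] is 1 for [j = 0] and 0
    otherwise. *)
Lemma ramanujan_sum_coprime r a : (0 < r)%N -> coprime r a ->
  ramanujan_sum r a = mobius r :> R[i].
Proof.
elim/ltn_ind: r => r IH r0 co.
case: (ltngtP r 1%N) => [|r1|->]; first by rewrite ltnS leqNgt r0.
  have p_pr := pdiv_prime r1; set p := pdiv r in p_pr.
  have [m pm rE] := pfactor_coprime p_pr r0.
  have : (0 < logn p r)%N by rewrite logn_gt0 mem_primes p_pr r0 pdiv_dvd.
  case: (logn p r) rE => // k rE _.
  have m0 : (0 < m)%N by move: r0; rewrite rE muln_gt0 => /andP[].
  have pk0 : (0 < p ^ k.+1)%N by rewrite expn_gt0 prime_gt0.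
  have mp : coprime m (p ^ k.+1) by rewrite coprimeXr // coprime_sym.
  move: (co); rewrite {1}rE coprimeMl => /andP[coma copa].
  rewrite rE ramanujan_sumM // mobiusM //; congr (_ * _).
    apply: IH => //; rewrite rE -{1}[m]muln1 ltn_mul2l m0.
    by rewrite -(expn0 p) ltn_exp2l // prime_gt1.
  rewrite ramanujan_sum_pfactor // mobius_pfactor // /root_sum.
  move: copa; rewrite coprime_pexpl // prime_coprime // => pa.
  have pj j : (p ^ j.+1 %| a)%N = false.
    by apply: contraNF pa => /(dvdn_trans _) ->; rewrite // expnS dvdn_mulr.
  by case: k {rE pk0 mp} => [|k]; rewrite !pj ?expn0 ?dvd1n ?sub0r ?oppr0.
by rewrite ramanujan_sum1.
Qed.

End Mobius.

(** * Integers with prescribed prime exponents *)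

Lemma prod_pfactor_gt0 (v : nat -> nat) (s : seq nat) :
  all prime s -> (0 < \prod_(p <- s) p ^ v p)%N.
Proof.
move=> s_pr; rewrite big_seq prodn_cond_gt0 // => p /(allP s_pr) p_pr.
by rewrite expn_gt0 prime_gt0.
Qed.

Lemma logn_prod_pfactor (v : nat -> nat) (s : seq nat) q :
  all prime s -> uniq s -> prime q ->
  logn q (\prod_(p <- s) p ^ v p)%N = (if q \in s then v q else 0)%N.
Proof.
move=> + + q_pr; elim: s => [|p s IH] /=; first by rewrite big_nil logn1.
case/andP=> p_pr s_pr /andP[ps us].
rewrite big_cons lognM ?prod_pfactor_gt0 ?expn_gt0 ?prime_gt0 //.
rewrite IH // inE lognX logn_prime //; case: eqP => [->|_] /=.
  by rewrite (negPf ps) muln1 addn0.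
by rewrite muln0 add0n.
Qed.

Lemma primes_prod_pfactor (v : nat -> nat) (s : seq nat) :
  all prime s -> uniq s -> (forall p, p \in s -> (0 < v p)%N) ->
  primes (\prod_(p <- s) p ^ v p)%N =i s.
Proof.
move=> s_pr us v0 q; case: (boolP (prime q)) => q_pr.
  rewrite -logn_gt0 logn_prod_pfactor //.
  by case: ifP => // qs; rewrite v0.
rewrite mem_primes (negPf q_pr) /=.
by apply/esym; apply: contraNF q_pr => /(allP s_pr).
Qed.

(** * Multiplicative coefficients *)

Section Coefficients.
Variables (R : realType) (G : nat -> R[i]).
Hypothesis Gmul : multiplicative_fun G.
Implicit Types (a p k : nat) (s t : seq nat).

Lemma coprime_multiplicativeM (f : nat -> R[i]) :
  coprime_multiplicative f -> coprime_multiplicative (fun q => G q * f q).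
Proof.
move=> fM m n m0 n0 co; rewrite fM // (proj2 Gmul) //.
by rewrite -!mulrA; congr (_ * _); rewrite mulrCA.
Qed.

Lemma series_to_mobius_sieve s t l : all prime (s ++ t) -> uniq (s ++ t) ->
  series_to (sieve (s ++ t)) (fun q => G q * mobius q) l ->
  series_to (sieve t) (fun q => G q * mobius q) ((\prod_(p <- s) (1 - G p)) * l).
Proof.
move=> st_pr ust Hl.
have -> : \prod_(p <- s) (1 - G p) =
    \prod_(p <- s) \sum_(k < 2) G (p ^ k)%N * mobius (p ^ k).
  rewrite big_seq [RHS]big_seq; apply: eq_bigr => p ps.
  have p_pr : prime p by apply: (allP st_pr); rewrite mem_cat ps.
  rewrite big_ord_recr big_ord1 /= expn0 (proj1 Gmul) mobius1 mulr1.
  by rewrite mobius_pfactor // expn1 mulrN1.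
apply: (series_to_sieve (N := fun=> 2%N)) => //.
  exact/coprime_multiplicativeM/mobiusM.
move=> p [|[|k]] ps // _; rewrite mobius_pfactor ?mulr0 //.
by apply: (allP st_pr); rewrite mem_cat ps.
Qed.

(** Integers that pass the sieve are prime to [a], where the Ramanujan sum equals [mobius]. Primes
    of [s] not dividing [a] are allowed, so that one sieved limit can be compared with several
    series. *)
Lemma series_to_ramanujan_sieve s a l : (0 < a)%N -> all prime s -> uniq s ->
  {subset primes a <= s} ->
  series_to (sieve s) (fun q => G q * mobius q) l ->
  series_to xpredT (fun q => G q * ramanujan_sum q a)
    ((\prod_(p <- s) \sum_(k < (logn p a).+2)
        G (p ^ k)%N * ramanujan_sum (p ^ k) a) * l).
Proof.
move=> a0 s_pr us sub Hl.
apply: (series_to_sieve (N := fun p => (logn p a).+2) (s := s) (t := [::])).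
- by apply: coprime_multiplicativeM => m n; apply: ramanujan_sumM.
- by rewrite cats0.
- by rewrite cats0.
- move=> p [//|k] ps; rewrite ltnS => ak.
  by rewrite ramanujan_sum_pfactor_eq0 ?mulr0 // (allP s_pr).
rewrite cats0; apply: eq_series_to Hl => // r r0 /allP sr.
rewrite ramanujan_sum_coprime // coprime_sieve //.
by apply/allP => p /sub; apply: sr.
Qed.

(** With [v = logn p a], the terms up to [v] telescope to [p ^ v], and the Ramanujan sum at
    [p ^ v.+1] is [- p ^ v]. *)
Lemma local_factor_eq p a : prime p -> (0 < a)%N ->
  (forall k, (k <= logn p a)%N -> G (p ^ k)%N = 1) ->
  \sum_(k < (logn p a).+2) G (p ^ k)%N * ramanujan_sum (p ^ k) a =
  (p ^ logn p a)%:R * (1 - G (p ^ (logn p a).+1)%N).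
Proof.
move=> p_pr a0 G1; rewrite big_ord_recr /=.
have G1E (k : 'I_(logn p a).+1) : G (p ^ k)%N = 1 by apply: G1; rewrite -ltnS.
under eq_bigr do rewrite G1E mul1r.
rewrite sum_ramanujan_sum_pfactor // ramanujan_sum_pfactor // /root_sum.
by rewrite !pfactor_dvdn // ltnn leqnn sub0r mulrN mulrBr mulr1 mulrC.
Qed.

(** Treats the normal case, with [s] empty, and the sporadic case together. *)
Lemma nonexotic_null_iff s :
  ~ exotic_coef G -> uniq s -> (forall p, p \in s <-> unit_primes G p) ->
  (forall a, (0 < a)%N ->
     series_cvg (fun r => coprime r a) (fun r => G r * mobius r)) ->
  ramanujan_coefficient G /\
  (null_coefficients G <-> series_to (sieve s) (fun q => G q * mobius q) 0).
Proof.
move=> nex us sF cv.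
have s_pr : all prime s by apply/allP => p /sF[].
have cancel (x y : R[i]) : x * y = 0 -> x != 0 -> y = 0.
  by move=> /eqP; rewrite mulf_eq0 => /orP[->|/eqP].
have cvs a t : (0 < a)%N -> primes a =i t ->
    exists l, series_to (sieve t) (fun q => G q * mobius q) l.
  move=> a0 at_; have [l Hl] := cv a a0; exists l.
  apply: eq_series_to Hl => // r r0.
  by rewrite coprime_sieve //; apply: eq_mem_sieve.
have prpr a : all prime (primes a).
  by apply/allP => p; rewrite mem_primes => /andP[].
split.
  move=> a a0; have [l Hl] := cvs a _ a0 (fun=> erefl).
  have sub : {subset primes a <= primes a} by [].
  by eexists; exact (series_to_ramanujan_sieve a0 (prpr a) (primes_uniq a) sub Hl).
split=> [nullG|L0 a a0].
  (* [(v p).+1] is the least exponent at which [G] differs from 1 along the powers of [p]. It exists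
     as [p] is not exotic, and is at least 2 since [G 1 = G p = 1]. *)
  have /choice[v vP] : forall p, exists w, p \in s ->
      [/\ (0 < w)%N, forall k, (k <= w)%N -> G (p ^ k)%N = 1
        & G (p ^ w.+1)%N != 1].
    move=> p; case: (boolP (p \in s)) => [ps|_]; last by exists 0%N.
    have [p_pr Gp] := (sF p).1 ps.
    have exK : exists K, G (p ^ K)%N != 1.
      apply: contrapT => nK; apply: nex; exists p; split=> // K.
      by apply/eqP; apply: contrapT => /negP ?; apply: nK; exists K.
    case: (ex_minnP exK) => [[|[|k]]]; rewrite ?expn0 ?expn1 ?(proj1 Gmul) ?Gp ?eqxx //.
    move=> Gk kmin; exists k.+1 => _; split=> // j jk.
    by apply/eqP; apply: contraLR jk => /kmin; rewrite -ltnNge.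
  (* For this [a] every local factor is [p ^ v p * (1 - G (p ^ (v p).+1))], hence nonzero, so a null
     Ramanujan series forces [l = 0]. *)
  pose a := (\prod_(p <- s) p ^ v p)%N; have a0 : (0 < a)%N := prod_pfactor_gt0 _ s_pr.
  have as_ : primes a =i s by apply: primes_prod_pfactor => // p /vP[].
  have [l Hl] := cvs a s a0 as_.
  have sub : {subset primes a <= s} by move=> p; rewrite as_.
  have /series_to_unique/(_ (nullG a a0)) :=
    series_to_ramanujan_sieve a0 s_pr us sub Hl.
  move=> /cancel lE; suff l0 : l = 0 by rewrite l0 in Hl.
  apply: lE; apply/negP; clear Hl; rewrite prodf_seq_eq0 => /hasP[p ps] /=.
  have [v0 G1 Gv] := vP p ps; have p_pr := allP s_pr p ps.
  have av : logn p a = v p by rewrite /a logn_prod_pfactor // ps.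
  have := local_factor_eq p_pr a0; rewrite av => ->; last exact: G1.
  rewrite mulf_eq0 => /orP[|].
    by rewrite pnatr_eq0 expn_eq0 (gtn_eqF (prime_gt0 p_pr)).
  by rewrite subr_eq0 eq_sym => /(negP Gv).
(* Conversely, for arbitrary [a], removing [s1] from the sieve multiplies the Möbius limit by
   factors [1 - G p], nonzero outside [s]. So the limit sieved by [s1 ++ s] is already 0. *)
pose s1 := [seq p <- primes a | p \notin s].
have ust : uniq (s1 ++ s).
  rewrite cat_uniq us filter_uniq ?primes_uniq // andbT /=.
  by apply/hasPn => p ps; rewrite mem_filter ps.
have st_pr : all prime (s1 ++ s).
  rewrite all_cat s_pr andbT; apply/allP => p; rewrite mem_filter.
  by case/andP => _; apply: allP.
(* The prime factors of [n] are exactly [s1 ++ s], so the convergence hypothesis applies at [n]. *)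
pose n := (a * \prod_(p <- s) p ^ 1)%N.
have n0 : (0 < n)%N by rewrite muln_gt0 a0 prod_pfactor_gt0.
have ns : primes n =i s1 ++ s.
  move=> p; rewrite primesM // ?prod_pfactor_gt0 // primes_prod_pfactor //.
  rewrite mem_cat mem_filter.
  by case: (p \in s); rewrite ?orbT ?orbF.
have [l Hl] := cvs n _ n0 ns.
have /series_to_unique/(_ L0) := series_to_mobius_sieve st_pr ust Hl.
move=> /cancel lE.
have l0 : l = 0.
  apply: lE; apply/negP; clear Hl; rewrite prodf_seq_eq0 => /hasP[p].
  rewrite mem_filter => /andP[ps pa] /=.
  rewrite subr_eq0 => /eqP Gp; case/negP: ps; apply/sF; split=> //.
  exact: (allP (prpr a)).
rewrite l0 in Hl.
have sub : {subset primes a <= s1 ++ s}.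
  by move=> p pa; rewrite mem_cat mem_filter pa andbT orNb.
by have := series_to_ramanujan_sieve a0 st_pr ust sub Hl; rewrite mulr0.
Qed.

(** At a prime with [G p = 1] the term is [-1], while the terms tend to 0. *)
Lemma unit_primes_finite :
  series_cvg xpredT (fun r => G r * mobius r) -> finite_set (unit_primes G).
Proof.
case=> l /series_to_term0/cvgr_dist_lt/(_ 1 ltr01)[N _ HN].
apply: (@sub_finite_set _ _ `I_N) => [p [p_pr Gp]|]; last exact: finite_II.
rewrite /= ltnNge; apply/negP => /HN /=.
rewrite Gp mul1r -(expn1 p) mobius_pfactor // opprK add0r.
by rewrite normr1 ltxx.
Qed.

Lemma exotic_prime_null p :
  exotic_prime G p ->
  (forall a, (0 < a)%N ->
     series_cvg (fun q => coprime q p) (fun q => G q * ramanujan_sum q a)) ->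
  null_coefficients G.
Proof.
move=> [p_pr Gp] cv a a0; have [l Hl] := cv a a0.
have {}Hl : series_to (sieve [:: p]) (fun q => G q * ramanujan_sum q a) l.
  apply: eq_series_to Hl => // r _.
  by rewrite coprime_sym prime_coprime //= andbT.
(* The limit 0 is read as the vanishing local factor at [p] times [l]. *)
rewrite -(mul0r l).
have <- : \sum_(k < (logn p a).+2) G (p ^ k)%N * ramanujan_sum (p ^ k) a = 0.
  by rewrite local_factor_eq // Gp subrr mulr0.
apply: (series_to_sieve1 (s := [::])) => //.
  by apply: coprime_multiplicativeM => m n; apply: ramanujan_sumM.
by move=> [//|k]; rewrite ltnS => ak; rewrite ramanujan_sum_pfactor_eq0 ?mulr0.
Qed.

End Coefficients.

(** * The trichotomy and its three cases *)

Unset Implicit Arguments.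
Set Strict Implicit.

Theorem theorem1 (R : realType) (G : nat -> R[i]) (Gmul : multiplicative_fun G) :
  [/\ exactly_one (normal_coef G) (sporadic_coef G) (exotic_coef G),
      (* (A) *)
      normal_coef G ->
      (forall a : nat, (0 < a)%N ->
         series_cvg (fun r => coprime r a) (fun r => G r * mobius r)) ->
      ramanujan_coefficient G /\
      (null_coefficients G <-> series_to xpredT (fun q => G q * mobius q) 0),
      (* (B) *)
      sporadic_coef G ->
      (forall a : nat, (0 < a)%N ->
         series_cvg (fun r => coprime r a) (fun r => G r * mobius r)) ->
      [/\ ramanujan_coefficient G,
          finite_set (unit_primes G) &
          (null_coefficients G <->
             series_to (fun q => coprime q (unit_primes_prod G))
                       (fun q => G q * mobius q) 0)] &
      (* (C) *)
      exotic_coef G ->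
      (exists p0 : nat, exotic_prime G p0 /\
         forall a : nat, (0 < a)%N ->
           series_cvg (fun q => coprime q p0)
                      (fun q => G q * ramanujan_sum q a)) ->
      ramanujan_coefficient G /\ null_coefficients G].
Proof.
have null_ram : null_coefficients G -> ramanujan_coefficient G.
  by move=> nG a a0; exists 0; apply: nG.
split.
- split.
    have [ex|nex] := pselect (exotic_coef G); first exact: Or33.
    have [[p Fp]|F0] := pselect (unit_primes G !=set0).
      by apply: Or32; split=> //; exists p.
    by apply: Or31 => p p_pr Gp; apply: F0; exists p.
  split=> [[nG [[p [p_pr Gp]] _]]|[nG [p [p_pr Gp]]]|[[_ nex] ex]] //.
    exact: nG Gp.
  by apply: (nG p p_pr); rewrite -(expn1 p).
- move=> nG cv.
  have nex : ~ exotic_coef G.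
    by case=> p [p_pr Gp]; apply: (nG p p_pr); rewrite -(expn1 p).
  have := nonexotic_null_iff Gmul nex (s := [::]) isT; apply=> // p.
  by split=> // -[p_pr Gp]; case: (nG p p_pr).
- case=> _ nex cv.
  have finF : finite_set (unit_primes G).
    (* At [a = 1] the coprimality condition is void, so the full Möbius series converges. *)
    apply: unit_primes_finite; have [l Hl] := cv 1%N isT; exists l.
    by apply: eq_series_to Hl => // r _; rewrite coprimen1.
  pose s : seq nat := finmap.enum_fset (fset_set (unit_primes G)).
  have sF p : p \in s <-> unit_primes G p.
    have -> : (p \in s) = (p \in unit_primes G) := in_fset_set finF p.
    by split=> [/set_mem|/mem_set].
  have us : uniq s by apply: finmap.fset_uniq.
  have s_pr : all prime s by apply/allP => p /sF[].
  (* By finiteness this is the genuine product; the exponent 1 gives it the shape of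
     [primes_prod_pfactor]. *)
  have PE : unit_primes_prod G = (\prod_(p <- s) p ^ 1)%N.
    under eq_bigr do rewrite expn1.
    exact: fsbig_finite.
  have sP r : (0 < r)%N -> sieve s r = coprime r (unit_primes_prod G).
    move=> r0; rewrite PE coprime_sieve ?prod_pfactor_gt0 //.
    by apply: eq_mem_sieve => p; rewrite primes_prod_pfactor.
  have [ramG [nullL Lnull]] := nonexotic_null_iff Gmul nex us sF cv.
  split=> //; split=> [/nullL|L0].
    by apply: eq_series_to.
  by apply: Lnull; apply: eq_series_to L0 => // r r0; rewrite sP.
- move=> _ [p0 [exp0 cv]].
  have nG := exotic_prime_null Gmul exp0 cv.
  by split=> //; apply: null_ram.
Qed.
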